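(* Let $(f,p):(F,A)_G\to(H,B)_K$ be a morphism in the soft group category $SGp$. If $f$ is an epimorphism in the category $Gp$ of groups and $p$ is an onto function in the category $Set$ of sets, then the morphism $(f,p)$ is epic in $SGp$.
   Context: A soft group $(F,A)_G$ over a group $G$ is a pair consisting of a set $A$ of parameters (a subset of some set $E$ of parameters) and a function $F:A\to P(G)$ into the power set of $G$ such that $F(a)$ is a subgroup of $G$ for every $a\in A$. For a group homomorphism $f:G\to K$, $\hat f:P(G)\to P(K)$ denotes the direct image map $\hat f(S)=f(S)$. A soft group homomorphism $(f,p):(F,A)_G\to(H,B)_K$ is a pair consisting of a group homomorphism $f:G\to K$ and a function $p:A\to B$ such that $\hat f\circ F=H\circ p$. Two soft group homomorphisms $(f,p)$ and $(g,q)$ are equal if and only if $f=g$ and $p=q$. $SGp$ is the category whose objects are soft groups (over arbitrary groups and parameter sets), whose morphisms are soft group homomorphisms, with componentwise composition $(g,q)\circ(f,p)=(g\circ f,q\circ p)$ and identities $(1_G,1_A)$. *)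

(* Defs.v *)
From mathcomp Require Import all_boot.
From mathcomp Require Import boolp classical_sets functions.

Set Implicit Arguments.
Unset Strict Implicit.
Unset Printing Implicit Defensive.

Local Open Scope classical_set_scope.

Record category := Category {
  obj :> Type;
  hom : obj -> obj -> Type;
  idm : forall X, hom X X;
  compm : forall X Y Z, hom Y Z -> hom X Y -> hom X Z;
  compm1 : forall X Y (u : hom X Y), compm u (idm X) = u;
  comp1m : forall X Y (u : hom X Y), compm (idm Y) u = u;
  compmA : forall X Y Z W (w : hom Z W) (v : hom Y Z) (u : hom X Y),
    compm w (compm v u) = compm (compm w v) u
}.

Definition epic (C : category) (X Y : C) (u : hom X Y) : Prop :=
  forall (Z : C) (v w : hom Y Z), compm v u = compm w u -> v = w.

(* In a group, preserving products entails preserving 1 and inverses, so that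
   {multiplicative G -> K} is the type of group homomorphisms. *)
Lemma multiplicative_ext (G K : groupType) (f g : {multiplicative G -> K}) :
  (f : G -> K) = g -> f = g.
Proof.
case: f g => [f [[mf]]] [g [[mg]]] /= efg; case: _ / efg mg => mg.
by rewrite (Prop_irrelevance mf mg).
Qed.

Definition gid (G : groupType) : {multiplicative G -> G} := idfun.

Definition gcomp (G K L : groupType) (g : {multiplicative K -> L})
  (f : {multiplicative G -> K}) : {multiplicative G -> L} := g \o f.

Definition Gp : category.
Proof.
apply: (@Category groupType (fun G K => {multiplicative G -> K}) gid gcomp).
- by move=> G K f; apply: multiplicative_ext.
- by move=> G K f; apply: multiplicative_ext.
- by move=> G K L M h g f; apply: multiplicative_ext.
Defined.

(* group_closed: contains 1 and is stable under (x, y) |-> x * y^-1. *)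
Record softGroup := SoftGroup {
  sgrp : groupType;
  sparam : Type;
  sfun : sparam -> set sgrp;
  sfunP : forall a, group_closed [in sfun a]
}.

Definition dimage (T U : Type) (f : T -> U) (S : set T) : set U := f @` S.

Record softHom (X Y : softGroup) := SoftHom {
  shom : {multiplicative sgrp X -> sgrp Y};
  smap : sparam X -> sparam Y;
  shomP : dimage shom \o @sfun X = @sfun Y \o smap
}.

Lemma softHom_ext (X Y : softGroup) (u v : softHom X Y) :
  shom u = shom v -> smap u = smap v -> u = v.
Proof.
case: u v => [f p fp] [g q gq] /= efg epq.
case: _ / efg gq; case: _ / epq => gq.
by rewrite (Prop_irrelevance fp gq).
Qed.

Lemma softHom_id_subproof (X : softGroup) :
  dimage (gid (sgrp X)) \o @sfun X = @sfun X \o idfun.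
Proof. by apply/funext => a; rewrite /= /dimage image_id. Qed.

Definition softHom_id (X : softGroup) : softHom X X :=
  SoftHom (softHom_id_subproof X).

Lemma softHom_comp_subproof (X Y Z : softGroup)
    (v : softHom Y Z) (u : softHom X Y) :
  dimage (gcomp (shom v) (shom u)) \o @sfun X =
  @sfun Z \o (smap v \o smap u).
Proof.
apply/funext => a.
have /= uP := congr1 (@^~ a) (shomP u).
have /= <- := congr1 (@^~ (smap u a)) (shomP v).
by rewrite -uP /dimage image_comp.
Qed.

Definition softHom_comp (X Y Z : softGroup)
    (v : softHom Y Z) (u : softHom X Y) : softHom X Z :=
  SoftHom (softHom_comp_subproof v u).

Definition SGp : category.
Proof.
apply: (@Category softGroup softHom softHom_id softHom_comp).
- by move=> X Y u; apply: softHom_ext => //; apply: multiplicative_ext.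
- by move=> X Y u; apply: softHom_ext => //; apply: multiplicative_ext.
- by move=> X Y Z W w v u; apply: softHom_ext => //; apply: multiplicative_ext.
Defined.

(* Main.v *)
Require Import Defs.
From mathcomp Require Import all_boot.
From mathcomp Require Import boolp classical_sets functions.

(** Composition in [SGp] is componentwise and a morphism is determined by its
    two components ([softHom_ext]), so right cancellation may be checked on
    each component separately: on the group side it is the hypothesis that the
    homomorphism is epic, on the parameter side it is the fact that a
    surjection is right cancellable. *)

Lemma surj_cancel_right {A B C : Type} {p : A -> B} {q r : B -> C} :
  set_surj [set: A]%classic [set: B]%classic p -> q \o p = r \o p -> q = r.
Proof.
move=> p_surj eqp; apply/funext => b.
have [a _ <-] := p_surj b I.
by have /= := congr1 (@^~ a) eqp.
Qed.

Theorem theorem3p9 (X Y : SGp) (u : hom X Y) :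
  epic (C := Gp) (X := sgrp X) (Y := sgrp Y) (shom u) ->
  set_surj [set: sparam X]%classic [set: sparam Y]%classic (smap u) ->
  epic u.
Proof.
move=> f_epic p_surj Z v w eq_vu_wu; apply: softHom_ext.
- exact: (f_epic (sgrp Z) _ _ (congr1 (@shom _ _) eq_vu_wu)).
- exact: (surj_cancel_right p_surj (congr1 (@smap _ _) eq_vu_wu)).
Qed.
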